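(* Let $m\ge2$ and $\Gamma=\Gamma_{V_{8m}}$. (1) If $m$ is even: $\mathrm{Spec}(\Gamma)=\{[0]^{2m-1},[-2]^1,[1+\sqrt{8m-7}]^1,[1-\sqrt{8m-7}]^1\}$, $E(\Gamma)=2(1+\sqrt{8m-7})$; $\mathrm{L\text{-}Spec}(\Gamma)=\{[0]^1,[4]^{2m-3},[2m]^2,[2(m+1)]^2\}$, $LE(\Gamma)=\frac{16(m-1)(m-2)}{m+1}+8$; $\mathrm{Q\text{-}Spec}(\Gamma)=\{[4]^{2m-3},[2m]^2,[2(m-1)]^1,[m+3+\sqrt{(m-1)(m+7)}]^1,[m+3-\sqrt{(m-1)(m+7)}]^1\}$, and $SE(\Gamma)=8$ if $m=2$, $SE(\Gamma)=\frac{16(m-1)(m-2)}{m+1}+2(m-1)(\sqrt{1+\frac{8}{m-1}}-1)$ if $m\ne2$. (2) If $m$ is odd: $\mathrm{Spec}(\Gamma)=\{[0]^{2m-2},[-1]^1,[\tfrac{1+\sqrt{16m-7}}{2}]^1,[\tfrac{1-\sqrt{16m-7}}{2}]^1\}$, $E(\Gamma)=1+\sqrt{16m-7}$; $\mathrm{L\text{-}Spec}(\Gamma)=\{[0]^1,[2]^{2m-2},[2m+1]^2\}$, $LE(\Gamma)=\frac{(4m-2)^2+8}{2m+1}$; $\mathrm{Q\text{-}Spec}(\Gamma)=\{[2]^{2m-2},[2m-1]^1,[\tfrac{2m+3+\sqrt{(2m-1)(2m+7)}}{2}]^1,[\tfrac{2m+3-\sqrt{(2m-1)(2m+7)}}{2}]^1\}$,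 $SE(\Gamma)=\frac{3(2m-1)(2m-3)}{2m+1}+(2m-1)\sqrt{1+\frac{8}{2m-1}}$.
   Context: $V_{8m}=\langle x,y\mid x^{2m}=y^4=1,\ yx=x^{-1}y^{-1},\ y^{-1}x=x^{-1}y\rangle$. For a finite non-abelian group $G$ with center $Z(G)$, the NCCC-graph $\Gamma_G$ has vertex set $\{x^G: x\in G\setminus Z(G)\}$ ($x^G$ the conjugacy class of $x$), distinct vertices $x^G,y^G$ adjacent iff $x'y'\neq y'x'$ for all $x'\in x^G,y'\in y^G$. For a simple graph with adjacency matrix $A$, degree matrix $D$, $L=D-A$, $Q=D+A$; Spec, L-Spec, Q-Spec are eigenvalue multisets of $A,L,Q$, $[\lambda]^k$ meaning eigenvalue $\lambda$ of multiplicity $k$. $E=\sum_{\lambda\in\mathrm{Spec}}|\lambda|$; with $\Delta=2|E(\mathcal G)|/|V(\mathcal G)|$, $LE=\sum_{\beta\in\mathrm{L\text{-}Spec}}|\beta-\Delta|$, $SE=\sum_{\gamma\in\mathrm{Q\text{-}Spec}}|\gamma-\Delta|$. *)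

(* Defs.v *)
From HB Require Import structures.
From mathcomp Require Import all_boot all_order all_algebra all_fingroup all_solvable.
Set Implicit Arguments. Unset Strict Implicit. Unset Printing Implicit Defensive.
Import GRing.Theory Num.Theory.

Definition nccc_vertices (gT : finGroupType) (G : {group gT}) : {set {set gT}} :=
  [set (x ^: G)%g | x in (G :\: 'Z(G))%g].

Definition nccc_adj (gT : finGroupType) (G : {group gT}) (C D : {set gT}) : bool :=
  (C != D) && [forall x in C, forall y in D, (x * y != y * x)%g].

Local Open Scope ring_scope.

Definition nccc_adjmx (R : nzRingType) (gT : finGroupType) (G : {group gT})
  : 'M[R]_#|nccc_vertices G| :=
  \matrix_(i, j) (nccc_adj G (enum_val i) (enum_val j))%:R.

Section Spectra.
Variables (R : rcfType) (n : nat).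

Definition degmx (A : 'M[R]_n) : 'M[R]_n := diag_mx (\row_i \sum_j A i j).
Definition laplmx (A : 'M[R]_n) : 'M[R]_n := degmx A - A.
Definition slaplmx (A : 'M[R]_n) : 'M[R]_n := degmx A + A.
Definition avgdeg (A : 'M[R]_n) : R := (\sum_i \sum_j A i j) / n%:R.

Definition spec_is (M : 'M[R]_n) (s : seq R) : Prop :=
  char_poly M = \prod_(l <- s) ('X - l%:P).

Definition energy_is (A : 'M[R]_n) (e : R) : Prop :=
  exists s, spec_is A s /\ e = \sum_(l <- s) `|l|.
Definition lapl_energy_is (A : 'M[R]_n) (e : R) : Prop :=
  exists s, spec_is (laplmx A) s /\ e = \sum_(b <- s) `|b - avgdeg A|.
Definition slapl_energy_is (A : 'M[R]_n) (e : R) : Prop :=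
  exists s, spec_is (slaplmx A) s /\ e = \sum_(g <- s) `|g - avgdeg A|.
End Spectra.

(* Main.v *)
(** The relations say that [y x] and [y^-1 x] are involutions. Hence [z = y^2] is
    central and [x^y = x^-1 z], so that [A = <x, z>] is abelian of index 2,
    [N = <x^2, z>] is normal with quotient of order 4 and ['Z(G)] lies in [N].
    Two elements of [G \ 'Z(G)] have commuting conjugates iff they lie in the
    same one of the three sets [A \ 'Z(G)], [y N] and [G \ (A u y N)], so the
    graph is complete tripartite: [K_(2m-2, 2, 2)] for even [m] and
    [K_(2m-1, 1, 1)] for odd [m]. The adjacency, Laplacian and signless Laplacian
    matrices of such a graph are constant on blocks up to a diagonal matrix, which
    reduces each characteristic polynomial to a 3 x 3 determinant. *)

Require Import Defs.
From HB Require Import structures.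
From mathcomp Require Import all_boot all_order all_algebra all_fingroup all_solvable.
From mathcomp Require Import ring lra zify.
Import Order.TTheory GRing.Theory Num.Theory.
Set Implicit Arguments.
Unset Strict Implicit.
Unset Printing Implicit Defensive.

(** * The presentation: a permutation model and the lower bound on the order *)

Local Open Scope group_scope.

(* Acting on two disjoint polygons, with [x] a rotation of the [2m]-gon and a
   reflection of the square, and [y] the other way round, makes both [y x] and
   [y^-1 x] products of a rotation and a reflection, hence involutions. *)
Lemma V8m_model (m : nat) : (1 < m)%N ->
  exists x y : {perm 'Z_(2 * m) + 'Z_4},
    [/\ x ^+ (2 * m) = 1, y ^+ 4 = 1, y * x = x^-1 * y^-1, y^-1 * x = x^-1 * y
      & (8 * m <= #|<[x]> <*> <[y]>|)%N].
Proof.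
move=> m_gt1.
pose fx (u : 'Z_(2 * m) + 'Z_4) : 'Z_(2 * m) + 'Z_4 :=
  match u with inl i => inl (i + 1)%R | inr j => inr (- j)%R end.
pose fy (u : 'Z_(2 * m) + 'Z_4) : 'Z_(2 * m) + 'Z_4 :=
  match u with inl i => inl (- i)%R | inr j => inr (j + 1)%R end.
have fx_inj : injective fx.
  pose gx (u : 'Z_(2 * m) + 'Z_4) : 'Z_(2 * m) + 'Z_4 :=
    match u with inl i => inl (i - 1)%R | inr j => inr (- j)%R end.
  apply: (can_inj (g := gx)).
  by case=> u /=; rewrite ?addrK ?opprK.
have fy_inj : injective fy.
  pose gy (u : 'Z_(2 * m) + 'Z_4) : 'Z_(2 * m) + 'Z_4 :=
    match u with inl i => inl (- i)%R | inr j => inr (j - 1)%R end.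
  apply: (can_inj (g := gy)).
  by case=> u /=; rewrite ?addrK ?opprK.
pose x := perm fx_inj; pose y := perm fy_inj.
have xl n i : (x ^+ n) (inl i) = inl (i + n%:R)%R.
  elim: n i => [|n IHn] i; first by rewrite perm1 addr0.
  by rewrite expgS permM permE /= IHn -addrA -mulrS.
have yr n j : (y ^+ n) (inr j) = inr (j + n%:R)%R.
  elim: n j => [|n IHn] j; first by rewrite perm1 addr0.
  by rewrite expgS permM permE /= IHn -addrA -mulrS.
have xr n j : (x ^+ n) (inr j) = inr ((-1) ^+ n * j)%R.
  elim: n j => [|n IHn] j; first by rewrite perm1 mul1r.
  by rewrite expgS permM permE /= IHn mulrN exprSr mulrN1 mulNr.
have yl n i : (y ^+ n) (inl i) = inl ((-1) ^+ n * i)%R.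
  elim: n i => [|n IHn] i; first by rewrite perm1 mul1r.
  by rewrite expgS permM permE /= IHn mulrN exprSr mulrN1 mulNr.
have x2m : x ^+ (2 * m) = 1.
  apply/permP => -[i|j]; rewrite perm1 ?xl ?xr.
    by rewrite pchar_Zp ?addr0 //; lia.
  by rewrite exprM sqrrN expr1n expr1n mul1r.
have y4 : y ^+ 4 = 1.
  apply/permP => -[i|j]; rewrite perm1 ?yl ?yr.
    by rewrite -[4%N]/(2 * 2)%N exprM sqrrN !expr1n mul1r.
  by rewrite pchar_Zp ?addr0.
have inv2 (u v : {perm 'Z_(2 * m) + 'Z_4}) : (u * v) * (u * v) = 1 -> u * v = v^-1 * u^-1.
  by rewrite -invMg => /eqP; rewrite -eq_invg_mul => /eqP.
exists x, y; split => //.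
- apply: inv2; apply/permP => -[i|j]; rewrite !permM perm1 !permE /=.
    by congr inl; ring.
  by congr inr; ring.
- have -> : y^-1 * x = x^-1 * y^-1^-1; last by rewrite invgK.
  apply: inv2; rewrite (_ : y^-1 = y ^+ 3); last first.
    by apply/eqP; rewrite eq_invg_mul -expgS y4.
  apply/permP => -[i|j]; rewrite !permM perm1 ?yl ?yr !permE /= ?yl ?yr /=.
    by congr inl; ring.
  by congr inr; ring.
pose f (u : 'Z_(2 * m) * 'Z_4) := x ^+ u.1 * y ^+ u.2.
have inlI : injective (@inl 'Z_(2 * m) 'Z_4) by move=> u v [].
have inrI : injective (@inr 'Z_(2 * m) 'Z_4) by move=> u v [].
(* [x] fixes [inr 0], so the image of that point reveals the exponent of [y]; the image of [inl 0]
   is then the exponent of [x] up to the unit [(-1) ^+ k]. *)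
have f_inj : injective f.
  move=> [i k] [j l] /permP fE; rewrite /f /= in fE.
  have := fE (inr 0%R); rewrite !permM !xr !mulr0 !yr !add0r => /inrI.
  rewrite !natr_Zp => kl; rewrite {}kl in fE *.
  have := fE (inl 0%R); rewrite !permM !xl !add0r !yl => /inlI/mulrI.
  by rewrite !natr_Zp unitrX ?unitrN1 // => ->.
have <- : #|f @: [set: 'Z_(2 * m) * 'Z_4]| = (8 * m)%N.
  rewrite card_imset // cardsT card_prod !card_ord !Zp_cast //; lia.
apply/subset_leq_card/subsetP => _ /imsetP[u _ ->].
by rewrite groupM // mem_gen // inE mem_cycle ?orbT.
Qed.

(** The presented group maps onto any group satisfying the relations, in particular onto the
    permutation model, which bounds its order from below. The matching upper bound comes later, from
    [G = <[x]> * <[y]>]. *)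
Lemma V8m_generators (gT : finGroupType) (G : {group gT}) (m : nat) :
  (1 < m)%N ->
  G \isog Grp (x : y : (x ^+ (2 * m) = 1, y ^+ 4 = 1,
                 y * x = x^-1 * y^-1, y^-1 * x = x^-1 * y)) ->
  (8 * m <= #|G|)%N /\
  exists x y : gT, [/\ <[x]> <*> <[y]> = G, x ^+ (2 * m) = 1, y ^+ 4 = 1,
    y * x = x^-1 * y^-1 & y^-1 * x = x^-1 * y].
Proof.
move=> m_gt1 isoG; split.
  have [x [y [x2m y4 yx yVx leH]]] := V8m_model m_gt1.
  apply: leq_trans leH _; apply: leq_homg.
  by rewrite isoG; apply/existsP; exists (x, y); rewrite /= x2m y4 yx yVx !eqxx.
have /existsP[[x y] /= /eqP[GE x2m y4 yx yVx]] := isoGrp_hom isoG.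
by exists x, y.
Qed.

(** * Counting classes in a normalised set, and subgroups of index 2 *)

Lemma card_classes_in (gT : finGroupType) (G : {group gT}) (S : {set gT}) c :
  G \subset 'N(S) -> {in S, forall g, #|g ^: G| = c} ->
  #|S| = (#|[set g ^: G | g in S]| * c)%N.
Proof.
move=> nS cS; apply: card_uniform_partition; last first.
  by apply: (orbit_partition (to := 'J)); rewrite /acts_on astabsJ.
by move=> _ /imsetP[g gS ->]; apply: cS.
Qed.

(** The complement of [H] in [K] is the single left coset [a *: H], and it contains [b]. *)
Lemma index2_mulVg (gT : finGroupType) (H K : {group gT}) a b :
  H \subset K -> #|K| = (2 * #|H|)%N ->
  a \in K -> a \notin H -> b \in K -> b \notin H -> a^-1 * b \in H.
Proof.
move=> sHK cHK aK aH bK bH.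
suff E : a *: H = K :\: H by rewrite -mem_lcoset E inE bH.
apply/eqP; rewrite eqEcard card_lcoset cardsD (setIidPr sHK) cHK.
rewrite mul2n -addnn addnK leqnn andbT.
apply/subsetP => _ /lcosetP[h hH ->].
by rewrite inE groupMr // aH groupM // (subsetP sHK).
Qed.

(** * Orders, normal subgroups, centre and class sizes *)

Section V8mStructure.

Variables (gT : finGroupType) (G : {group gT}) (x y : gT) (m : nat).
Hypotheses (m_gt1 : (1 < m)%N) (leG : (8 * m <= #|G|)%N).
Hypotheses (genG : <[x]> <*> <[y]> = G) (x2m : x ^+ (2 * m) = 1) (y4 : y ^+ 4 = 1).
Hypotheses (yx : y * x = x^-1 * y^-1) (yVx : y^-1 * x = x^-1 * y).

Local Notation z := (y ^+ 2).
Local Notation A := (<[x]> <*> <[z]>)%G.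
Local Notation N := (<[x ^+ 2]> <*> <[z]>)%G.

Let xG : x \in G. Proof. by rewrite -genG mem_gen // inE cycle_id. Qed.
Let yG : y \in G. Proof. by rewrite -genG mem_gen // inE cycle_id orbT. Qed.
Let z2 : z ^+ 2 = 1. Proof. by rewrite -expgM. Qed.

(** The two relations give [y * x * y = x^-1 = y^-1 * x * y^-1]; hence [z * x * z = x], and [z] is
    its own inverse. *)
Let zx : commute x z.
Proof.
have E1 : y * x * y = x^-1 by rewrite yx mulgKV.
have E2 : y^-1 * x * y^-1 = x^-1 by rewrite yVx mulgK.
rewrite -E1 in E2.
rewrite /commute; have -> : x * z = y * (y^-1 * x * y^-1) * (y * z).
  by rewrite !mulgA mulgV mul1g mulgKV.
by rewrite E2 -[RHS]mulg1 -y4 !expgS !expg0 !mulg1 !mulgA.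
Qed.

Let zxV : commute x^-1 z. Proof. exact/commute_sym/commuteV/commute_sym. Qed.

Let xy : x ^ y = x^-1 * z.
Proof. by rewrite conjgE mulgA yVx -mulgA. Qed.

Let zJ g : g \in G -> commute g z.
Proof.
suff : G \subset 'C[z] by move=> /subsetP sG /sG /cent1P.
rewrite -genG join_subG !cycle_subG; apply/andP; split; apply/cent1P => //.
exact: commuteX.
Qed.

Let AE : A = (<[x]> * <[z]>)%g :> {set gT}.
Proof. by apply: cent_joinEr; rewrite /= cent_cycle cycle_subG; apply/cent1P/esym. Qed.

Let yA a : a \in A -> a ^ y \in A.
Proof.
rewrite /= AE => /imset2P[_ _ /cycleP[i ->] /cycleP[j ->] ->].
rewrite conjMg !conjXg xy [y ^ y]conjgE mulKg (expgMn _ zxV).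
by rewrite -mulgA mem_mulg ?groupM ?mem_cycle // expgVn groupV mem_cycle.
Qed.

(** Since [y] normalises [A = <[x]> * <[z]>], the group is [A * <[y]>], and [<[z]>] is absorbed by
    [<[y]>]. *)
Let GE : G = (<[x]> * <[y]>)%g :> {set gT}.
Proof.
have nyA : <[y]> \subset 'N(A).
  rewrite cycle_subG inE; apply/subsetP => _ /imsetP[a aA ->]; exact: yA.
have -> : G = A <*> <[y]> :> {set gT}.
  rewrite -genG /= -joingA; congr (_ <*> _); rewrite joingC.
  by apply/esym/joing_idPl; rewrite cycle_subG mem_cycle.
rewrite norm_joinEr // AE -mulgA mulSGid //.
by rewrite cycle_subG mem_cycle.
Qed.

(** The product formula gives [#|G|] times the order of the intersection as [#[x] * #[y]], which is
    at most [8 * m]; with [leG] every inequality becomes an equality. *)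
Let orders : [/\ #[x] = (2 * m)%N, #[y] = 4%N, #|G| = (8 * m)%N & <[x]> :&: <[y]> = 1].
Proof.
have ox : (#[x] <= 2 * m)%N by rewrite dvdn_leq ?order_dvdn ?x2m //; lia.
have oy : (#[y] <= 4)%N by rewrite dvdn_leq ?order_dvdn ?y4.
have := mul_cardG <[x]> <[y]>; rewrite -GE -!orderE => E.
have I0 : (0 < #|<[x]> :&: <[y]>|)%N by rewrite cardG_gt0.
have le8 := leq_mul ox oy; rewrite E in le8.
have I1 : #|<[x]> :&: <[y]>| = 1%N.
  by move: leG le8 I0; move: #|_ :&: _| #|G| => [|[|i]] g; nia.
have ti : <[x]> :&: <[y]> = 1 by apply/eqP; rewrite trivg_card1 I1.
move: leG ox oy E; rewrite I1 muln1; clear -m_gt1 ti.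
by move: #[x] #[y] #|G| => a b g *; split=> //; nia.
Qed.

Let oz : #[z] = 2.
Proof. by have [_ oy _ _] := orders; rewrite orderXdiv oy. Qed.

Let tiz k : <[x ^+ k]> :&: <[z]> = 1.
Proof.
have [_ _ _ ti] := orders; apply/trivgP; rewrite -ti setISS // cycle_subG mem_cycle //.
Qed.

Let cardA : #|A| = (4 * m)%N.
Proof.
have [ox _ _ _] := orders.
by rewrite /= AE TI_cardMg ?(tiz 1) // -!orderE ox oz; lia.
Qed.

Let NE : N = (<[x ^+ 2]> * <[z]>)%g :> {set gT}.
Proof.
apply: cent_joinEr; rewrite /= cent_cycle cycle_subG; apply/cent1P.
exact/commuteX/esym.
Qed.

Let cardN : #|N| = (2 * m)%N.
Proof.
have [ox _ _ _] := orders.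
rewrite /= NE TI_cardMg ?tiz // -!orderE oz orderXdiv ox ?dvdn_mulr //.
by rewrite mulKn // mulnC.
Qed.

Let sAG : A \subset G.
Proof. by rewrite join_subG !cycle_subG groupX ?xG. Qed.
Let sNA : N \subset A.
Proof. by rewrite genS // setSU // cycle_subG mem_cycle. Qed.

Let abA a b : a \in A -> b \in A -> commute a b.
Proof.
move=> aA bA; suff : abelian A by move/centsP; apply.
rewrite /= abelianY !cycle_abelian /= cent_cycle cycle_subG.
exact/cent1P/esym.
Qed.

Let cardG2A : #|G| = (2 * #|A|)%N.
Proof. by have [_ _ -> _] := orders; rewrite cardA; lia. Qed.
Let cardA2N : #|A| = (2 * #|N|)%N.
Proof. by rewrite cardA cardN; lia. Qed.

Let nA : A <| G.
Proof. by apply: index2_normal => //; rewrite -divgS // cardG2A mulnK // cardG_gt0. Qed.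

Let nN : G \subset 'N(N).
Proof.
rewrite normsY // -genG join_subG; apply/andP; split; rewrite ?cycle_subG.
- apply: (subsetP (sub_abelian_norm _ _)) (cycle_id x).
    exact: cycle_abelian.
  by rewrite cycle_subG mem_cycle.
- rewrite -cycle_subG norms_cycle conjXg xy (expgMn _ zxV).
  by rewrite z2 mulg1 expgVn groupV cycle_id.
- by rewrite (subsetP (cent_sub _)) // cent_cycle; apply/cent1P.
by rewrite (subsetP (cent_sub _)) // cent_cycle; apply/cent1P/commuteX.
Qed.

(** The quotient by [N] has order 4, so it is abelian and [N] contains every commutator. Conjugation
    therefore preserves each coset of [N]. *)
Let conj_modN g h : g \in G -> h \in G -> g^-1 * g ^ h \in N.
Proof.
move=> gG hG; rewrite -commgEl.
have : G^`(1) \subset N.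
  apply: der1_min => //; apply: (@card_p2group_abelian _ 2) => //.
  rewrite card_quotient // -divgS ?(subset_trans sNA) //.
  by rewrite cardG2A cardA2N mulnA mulnK // cardG_gt0.
by move/subsetP; apply; rewrite derg1 mem_commg.
Qed.

(** [A] is abelian of index 2, so [A] and [h] together generate [G]. *)
Let comm_center g h : g \in A -> h \in G -> h \notin A -> commute g h -> g \in 'Z(G).
Proof.
move=> gA hG hA gh; apply/centerP; split; first exact: subsetP gA.
move=> k kG; have [kA|kA] := boolP (k \in A); first exact: abA.
rewrite -(mulKVg h k); apply: commuteM => //.
by apply: abA => //; apply: (index2_mulVg sAG).
Qed.

Let xA : x \in A. Proof. by rewrite mem_gen // inE cycle_id. Qed.

Let yx_ncomm : ~ commute y x.
Proof.
(* If [x] and [y] commuted, [x = x ^ y = x^-1 * z] would force [x ^+ 2 = z]. The form [x ^+ 1]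
   matches [tiz]. *)
move=> cyx; have : x ^+ 2 \in <[x ^+ 1]> :&: <[z]>.
  rewrite inE mem_cycle /=; suff -> : x ^+ 2 = z by rewrite cycle_id.
  have : x ^ y = x by rewrite conjgE -cyx mulKg.
  by rewrite xy => /(canRL (mulKVg _)) ->; rewrite expgS expg1.
rewrite tiz => /set1gP x2; have [ox _ _ _] := orders.
have := order_dvdn x 2; rewrite x2 eqxx ox => /dvdn_leq; lia.
Qed.

Let yNA : y \notin A.
Proof. by apply/negP => yinA; apply: yx_ncomm; apply: abA. Qed.

Let center_sA : 'Z(G) \subset A.
Proof.
apply/subsetP => g /centerP[gG gZ]; apply/negPn/negP => gA; apply: yx_ncomm.
have /abA/(_ xA) c : y^-1 * g \in A by apply: (index2_mulVg sAG).
rewrite -[y]invgK; apply/commute_sym/commuteV; rewrite -(mulgK g y^-1).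
by apply/commuteM/commuteV; apply: commute_sym => //; apply: gZ.
Qed.

(** Commuting with [y] means [z ^+ i = x ^+ (2 * i)]. As [<[x]>] and [<[z]>] meet trivially, both
    sides are 1, and the orders of [z] and [x] give the two divisibilities. *)
Let center_exp i j : x ^+ i * z ^+ j \in 'Z(G) -> ((2 %| i) && (m %| i))%N.
Proof.
move=> /centerP[_ /(_ y yG) c].
have : (x ^+ i * z ^+ j) ^ y = x ^+ i * z ^+ j by rewrite conjgE c mulKg.
rewrite conjMg !conjXg xy [y ^ y]conjgE mulKg (expgMn _ zxV) => /mulIg E.
have {}E : z ^+ i = x ^+ (2 * i).
  apply: (mulgI (x^-1 ^+ i)); rewrite E expgVn mulnC -[(i * 2)%N]/(i * 1.+1)%N.
  by rewrite mulnS muln1 expgD mulKg.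
have zi : z ^+ i \in <[x ^+ 1]> :&: <[z]> by rewrite inE {1}E !mem_cycle.
have [ox _ _ _] := orders.
move: zi; rewrite tiz => /set1gP zi; rewrite zi in E.
have := order_dvdn z i; rewrite zi eqxx oz => ->.
have := order_dvdn x (2 * i); rewrite -E eqxx ox => /idP.
by rewrite dvdn_pmul2l.
Qed.

Let memA g : g \in A -> exists i j, g = x ^+ i * z ^+ j.
Proof.
by rewrite /= AE => /imset2P[_ _ /cycleP[i ->] /cycleP[j ->] ->]; exists i, j.
Qed.

Let center_sN : 'Z(G) \subset N.
Proof.
apply/subsetP => g gZ; have [i [j gE]] := memA (subsetP center_sA _ gZ).
move: gZ; rewrite {}gE => /center_exp/andP[/dvdnP[k ->] _].
by rewrite /= NE mulnC expgM mem_mulg ?mem_cycle.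
Qed.

(** For odd [m] the exponent of [x] in a central element is divisible by [2 * m], which leaves
    [<[z]>]. For even [m] it is a multiple of [m], and [x ^+ m] is central because [z ^+ m = 1]. *)
Let card_center : #|'Z(G)| = (if odd m then 2 else 4)%N.
Proof.
have [ox _ _ _] := orders.
have zZ : <[z]> \subset 'Z(G).
  by rewrite cycle_subG; apply/centerP; split=> [|g /zJ]; rewrite ?groupX.
case: ifP => [m_odd|/negbT m_even].
  suff -> : 'Z(G) = <[z]> by rewrite -orderE oz.
  apply/eqP; rewrite eqEsubset zZ andbT; apply/subsetP => g gZ.
  have [i [j gE]] := memA (subsetP center_sA _ gZ).
  move: gZ; rewrite {}gE => /center_exp; rewrite -Gauss_dvd ?coprime2n // -ox order_dvdn.
  by move/eqP->; rewrite mul1g mem_cycle.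
have -> : 'Z(G) = (<[x ^+ m]> * <[z]>)%g.
  apply/eqP; rewrite eqEsubset; apply/andP; split.
    apply/subsetP => g gZ.
    have [i [j gE]] := memA (subsetP center_sA _ gZ).
    move: gZ; rewrite {}gE => /center_exp/andP[_ /dvdnP[k ->]].
    by rewrite mulnC expgM mem_mulg ?mem_cycle.
  rewrite mul_subG // cycle_subG; apply: (@comm_center _ y) => //.
    by rewrite groupX.
  suff xmy : (x ^+ m) ^ y = x ^+ m by rewrite /commute -{2}xmy conjgE mulKVg.
  have zm : z ^+ m = 1.
    by apply/eqP; rewrite -order_dvdn oz dvdn2.
  rewrite conjXg xy (expgMn _ zxV) zm mulg1 expgVn; apply/eqP.
  by rewrite eq_invg_mul -expgD addnn -mul2n x2m.
by rewrite TI_cardMg ?tiz // -!orderE oz orderXdiv ox ?dvdn_mull // mulnK // ltnW.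
Qed.

Let card_class_A g : g \in A :\: 'Z(G) -> #|g ^: G| = 2.
Proof.
case/setDP => gA gZ; rewrite -index_cent1.
have gG := subsetP sAG _ gA.
have sAC : A \subset 'C_G[g].
  by rewrite subsetI sAG; apply/subsetP => a aA; apply/cent1P/abA.
have dvd2 : (#|G : 'C_G[g]| %| 2)%N.
  have <- : #|G : A| = 2 by rewrite -divgS // cardG2A mulnK // cardG_gt0.
  exact: indexgS.
have ne1 : #|G : 'C_G[g]| != 1%N.
  rewrite indexg_eq1; apply: contra gZ => /subsetP sGC.
  apply/centerP; split=> // h /sGC /setIP[_ /cent1P]; exact: commute_sym.
by move: dvd2 ne1; rewrite dvdn_divisors //= !inE => /orP[]/eqP->.
Qed.

(** The centraliser of [g] meets [A] in the centre, and it is not contained in [A] since it contains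
    [g], so its product with [A] is [G]. Its order is thus twice that of the centre. *)
Let card_class_notA g : g \in G :\: A -> (#|g ^: G| * #|'Z(G)| = 4 * m)%N.
Proof.
case/setDP => gG gA; rewrite -index_cent1.
have AC : A :&: 'C_G[g] = 'Z(G).
  apply/setP => a; apply/setIP/idP => [[aA /setIP[aG /cent1P ag]]|aZ].
    exact: (comm_center aA gG).
  split; first exact: subsetP center_sA _ aZ.
  by case/centerP: aZ => aG aZ; apply/setIP; split=> //; apply/cent1P/aZ.
have GAC : (A * 'C_G[g])%g = G.
  apply/eqP; rewrite eqEsubset mul_subG ?subsetIl //=; apply/subsetP => k kG.
  have gC : g \in 'C_G[g] by rewrite inE gG cent1id.
  have [kA|kA] := boolP (k \in A); first by rewrite -[k]mulg1 mem_mulg.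
  rewrite -(mulgKV g k) mem_mulg //.
  have := index2_mulVg sAG cardG2A _ _ _ _ (a := k^-1) (b := g^-1).
  by rewrite !groupV invgK; apply.
have := mul_cardG A 'C_G[g]; rewrite /= AC GAC => E.
have L : (#|'C_G[g]| * #|G : 'C_G[g]| = #|G|)%N by rewrite Lagrange ?subsetIl.
have C0 : (0 < #|'C_G[g]|)%N by rewrite cardG_gt0.
apply/eqP; rewrite -(eqn_pmul2l C0) mulnA L -E mulnC -cardA; exact: eqxx.
Qed.

(** * The tripartition of the non-central elements and their classes *)

(** The values 1 and 2 separate the two cosets of [N] outside [A]. Central elements receive [ord0]
    as well, but they are never vertices. *)
Definition part_of g : 'I_3 :=
  if g \in A then ord0 else if y^-1 * g \in N then lift ord0 ord0
  else lift ord0 (lift ord0 ord0).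

Let part_ofJ g h : g \in G -> h \in G -> part_of (g ^ h) = part_of g.
Proof.
move=> gG hG; rewrite /part_of memJ_norm ?(subsetP (normal_norm nA)) //.
by rewrite -[g ^ h](mulKVg g) mulgA groupMr // conj_modN.
Qed.

Let part_of_eq a b : a \in G :\: A -> b \in G :\: A ->
  (part_of a == part_of b) = (a^-1 * b \in N).
Proof.
move=> /setDP[aG aA] /setDP[bG bA]; rewrite /part_of (negPf aA) (negPf bA).
have -> : a^-1 * b = (y^-1 * a)^-1 * (y^-1 * b) by rewrite invMg invgK mulgA mulgK.
have aN := index2_mulVg sAG cardG2A yG yNA aG aA.
have bN := index2_mulVg sAG cardG2A yG yNA bG bA.
case: ifP => a1; case: ifP => b1; rewrite ?eqxx.
- by rewrite groupM ?groupV.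
- by rewrite groupMl ?groupV // b1.
- by rewrite groupMr ?groupV // a1.
by rewrite (index2_mulVg sNA) ?a1 ?b1.
Qed.

(** If just one of the two lies in [A], commuting would make it central. If neither does, [a^-1 * b]
    lies in [A] and would commute with [b], so it would be central and hence in [N], against the
    parts being different. *)
Let part_of_ncomm a b : a \in G :\: 'Z(G) -> b \in G :\: 'Z(G) ->
  part_of a != part_of b -> ~ commute a b.
Proof.
(* The assumption excludes only [a] inside and [b] outside [A], a case recovered by exchanging
   them. *)
wlog aA : a b / a \in A -> b \in A => [th|].
  have [aA|aA] := boolP (a \in A); last by apply: th => // /(negP aA).
  have [bA|bA] := boolP (b \in A); first by apply: th.
  move=> aGZ bGZ; rewrite eq_sym => ne /commute_sym; apply: th ne => //.
move=> /setDP[aG aZ] /setDP[bG bZ].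
have [bA|bA] := boolP (b \in A).
  have [aA'|aA'] := boolP (a \in A); first by rewrite /part_of bA aA' eqxx.
  by move=> _ /commute_sym/(comm_center bA aG aA'); apply/negP.
have aA' : a \notin A by apply: contra bA.
rewrite part_of_eq ?inE ?aA' ?bA // => abN ab.
have abA' := index2_mulVg sAG cardG2A aG aA' bG bA.
case/negP: abN; apply: (subsetP center_sN); apply: (comm_center abA' bG bA).
by apply/commute_sym/commuteM => //; apply/commuteV/commute_sym.
Qed.

(** Outside [A], one has [b = a * x ^+ (2 * i) * z ^+ j]. Since [x ^ a = x^-1 * z], conjugating [a]
    by [x ^+ i] multiplies it by [x ^+ (2 * i)] up to a power of [z]. So [b] is a conjugate of [a]
    times a central element. *)
Let part_of_comm a b : a \in G -> b \in G -> part_of a = part_of b ->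
  exists2 h, h \in G & commute (a ^ h) b.
Proof.
move=> aG bG; have [aA|aA] := boolP (a \in A).
  have [bA _|bA] := boolP (b \in A); first by exists 1; rewrite // conjg1; apply: abA.
  by rewrite /part_of aA (negPf bA); case: ifP.
have [bA|bA] := boolP (b \in A); first by rewrite /part_of bA (negPf aA); case: ifP.
move/eqP; rewrite part_of_eq ?inE ?aA ?bA //.
rewrite /= NE => /imset2P[_ _ /cycleP[i ->] /cycleP[j ->] abE].
have xa : x ^ a = x^-1 * z.
  have a'A := index2_mulVg sAG cardG2A yG yNA aG aA.
  rewrite -(mulKVg y a) conjgM xy; have wA : x^-1 * z \in A by rewrite -xy yA.
  by rewrite conjgE (abA wA a'A) mulKg.
exists (x ^+ i); first by rewrite groupX.
have aiG : a ^ (x ^+ i) \in G by rewrite groupJ ?groupX.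
have aiE : a ^ (x ^+ i) * z ^+ i = a * x ^+ (2 * i).
  have -> : a ^ (x ^+ i) = a * ((x ^+ i) ^ a)^-1 * x ^+ i.
    by rewrite !conjgE !invMg !invgK !mulgA mulgV mul1g.
  rewrite conjXg xa (expgMn _ zxV) invMg expgVn invgK -!mulgA; congr (_ * _).
  rewrite (mulgA (x ^+ i)) -expgD addnn -mul2n; apply: (canLR (mulKg _)).
  exact: commuteX2.
have -> : b = a ^ (x ^+ i) * z ^+ (i + j).
  by rewrite -(mulKVg a b) abE -expgM (expgD z i j) [RHS]mulgA aiE mulgA.
by apply: commuteM; [apply: commute_refl | apply/commuteX/zJ].
Qed.

Let adj_classes a b : a \in G :\: 'Z(G) -> b \in G :\: 'Z(G) ->
  nccc_adj G (a ^: G) (b ^: G) = (part_of a != part_of b).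
Proof.
move=> aGZ bGZ; have [/setDP[aG aZ] /setDP[bG bZ]] := (aGZ, bGZ).
have nGZ h g : h \in G -> g \in G :\: 'Z(G) -> g ^ h \in G :\: 'Z(G).
  move=> hG; rewrite memJ_norm //; apply: subsetP hG.
  exact: normsD (normG _) (normal_norm (center_normal _)).
apply/andP/idP => [[_ /'forall_in_forall_inP nc]|ne].
  apply/eqP => /(part_of_comm aG bG)[h hG ahb].
  by have /eqP := nc _ (memJ_class a hG) _ (class_refl G b); apply.
split; last first.
  apply/'forall_in_forall_inP => _ /imsetP[h hG ->] _ /imsetP[k kG ->].
  by apply/eqP; apply: part_of_ncomm; rewrite ?nGZ ?part_ofJ.
apply: contraNneq ne => abE; have := class_refl G a; rewrite abE => /imsetP[h hG ->].
by rewrite part_ofJ.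
Qed.

(** Classes in [A] off the centre have size 2, the others [4 * m / #|'Z(G)|]. Dividing
    [4 * m - #|'Z(G)|] and the coset size [2 * m] by these gives the numbers of classes. *)
Lemma nccc_adj_V8m_tripartite : exists p : {set gT} -> 'I_3,
  [/\ {in nccc_vertices G &, forall C D, nccc_adj G C D = (p C != p D)},
      #|[set C in nccc_vertices G | p C == ord0]|
        = (if odd m then 2 * m - 1 else 2 * m - 2)%N
    & forall a, a != ord0 ->
      #|[set C in nccc_vertices G | p C == a]| = (if odd m then 1 else 2)%N].
Proof.
(* Any representative would do, as [part_of] is constant on classes. *)
pose p (C : {set gT}) := part_of (repr C).
have pE g : g \in G -> p (g ^: G) = part_of g.
  move=> gG; rewrite /p; have /imsetP[h hG ->] := mem_repr _ (class_refl G g).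
  by rewrite part_ofJ.
have pD k (S : {set gT}) : S \subset G :\: 'Z(G) ->
    (forall g, g \in G :\: 'Z(G) -> (part_of g == k) = (g \in S)) ->
    [set C in nccc_vertices G | p C == k] = [set g ^: G | g in S].
  move=> sSG cS; apply/setP => C; rewrite inE; apply/andP/imsetP => [[]|].
    case/imsetP => g gGZ ->{C}; rewrite pE ?(subsetP (subsetDl _ _) _ gGZ) // cS // => gS.
    by exists g.
  case=> g gS ->{C}; have gGZ := subsetP sSG _ gS.
  by split; [exact: imset_f | rewrite pE ?(subsetP (subsetDl _ _) _ gGZ) // cS].
have nZ := normal_norm (center_normal G).
have nyN : G \subset 'N(y *: N).
  apply/subsetP => h hG; rewrite inE; apply/subsetP => _ /imsetP[k kN ->].
  have kG : k \in G.
    by case/lcosetP: kN => n nN' ->; rewrite groupM // (subsetP sAG) // (subsetP sNA).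
  move: kN; rewrite !mem_lcoset -[k ^ h](mulKVg k) mulgA => kN.
  by rewrite groupM // conj_modN.
have yNGA : y *: N \subset G :\: A.
  apply/subsetP => _ /lcosetP[n nN' ->]; have nA' := subsetP sNA _ nN'.
  by rewrite inE groupMr // yNA groupM // (subsetP sAG).
have sGZ (S : {set gT}) : S \subset G :\: A -> S \subset G :\: 'Z(G).
  by move=> sS; apply: subset_trans sS (setDS _ _).
have card_part (S : {set gT}) k :
    S \subset G :\: A -> G \subset 'N(S) -> #|S| = (2 * m)%N ->
    (forall g, g \in G :\: 'Z(G) -> (part_of g == k) = (g \in S)) ->
    #|[set C in nccc_vertices G | p C == k]| = (if odd m then 1 else 2)%N.
  move=> sS nS cS clsS; rewrite (pD _ S) ?sGZ //.
  have cE : {in S, forall g, #|g ^: G| = (if odd m then 2 * m else m)%N}.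
    move=> g /(subsetP sS)/card_class_notA; rewrite card_center.
    by move: #|_ ^: _| => c; case: ifP => _; clear; lia.
  have := card_classes_in nS cE; rewrite cS; move: #|[set _ | _ in _]| => c.
  by case: ifP => _; clear -m_gt1; nia.
exists p; split.
- by move=> _ _ /imsetP[g gGZ ->] /imsetP[h hGZ ->]; rewrite adj_classes // !pE //;
    [case/setDP: hGZ | case/setDP: gGZ].
- rewrite (pD _ (A :\: 'Z(G))) ?setSD //; last first.
    by move=> g /setDP[gG gZ]; rewrite /part_of inE gZ; case: ifP => //; case: ifP.
  have := @card_classes_in _ G (A :\: 'Z(G)) 2 (normsD (normal_norm nA) nZ) card_class_A.
  rewrite cardsD (setIidPr center_sA) cardA card_center.
  by move: #|[set _ | _ in _]| => c; case: ifP => _; clear; lia.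
move=> a a0.
have : a \in [:: ord0; lift ord0 ord0; lift ord0 (lift ord0 ord0)].
  by case: (a) => [[|[|[|?]]]] ?; rewrite !inE -!val_eqE.
rewrite !inE (negPf a0) /= => /orP[]/eqP->.
  apply: (card_part (y *: N)) => //; first by rewrite card_lcoset cardN.
  move=> g _; rewrite mem_lcoset /part_of; have [gA|gA] := boolP (g \in A).
    by apply/esym/negP => /(subsetP sNA); rewrite groupMr // groupV (negPf yNA).
  by case: ifP.
(* The last part is what remains outside [A], with [8 * m - 4 * m - 2 * m] elements. *)
apply: (card_part ((G :\: A) :\: (y *: N))).
- exact: subsetDl.
- by rewrite !normsD // ?normal_norm // normG.
- rewrite cardsD (setIidPr yNGA) card_lcoset cardsD (setIidPr sAG) cardN cardA.
  by have [_ _ -> _] := orders; clear; lia.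
move=> g /setDP[gG gZ]; rewrite !inE gG mem_lcoset /part_of; case: ifP => //=.
  by rewrite andbF.
by rewrite andbT; case: ifP.
Qed.

End V8mStructure.

(* Characteristic polynomials of block-constant matrices *)
Local Close Scope group_scope.
Local Open Scope ring_scope.

Lemma det_mx33 (R : comNzRingType) (M : 'M[R]_3) :
  let m i j := M (inord i) (inord j) in
  \det M = m 0 0 * (m 1 1 * m 2 2 - m 1 2 * m 2 1)
         - m 0 1 * (m 1 0 * m 2 2 - m 1 2 * m 2 0)
         + m 0 2 * (m 1 0 * m 2 1 - m 1 1 * m 2 0).
Proof.
move=> m.
have mE i j : M i j = m i j by rewrite /m !inord_val.
rewrite (expand_det_row _ ord0) !big_ord_recl big_ord0 /cofactor.
rewrite !(expand_det_row _ ord0) !big_ord_recl !big_ord0 /cofactor.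
by rewrite !det_mx11 !mxE !mE /bump /=; ring.
Qed.

(* The determinant of [M1 = [N, P; B P^T, 1]] is the characteristic polynomial
   of the matrix, and right multiplication by [[1, -P; 0, N3]] makes [M1] block
   lower triangular because [N P = P N3]. *)
Lemma char_poly_block_constant (R : comNzRingType) n k (p : 'I_n -> 'I_k)
    (d : 'I_k -> R) (b : 'I_k -> 'I_k -> R) :
  char_poly (\matrix_(i, j) (d (p i) *+ (i == j) + b (p i) (p j)))
    * \prod_a ('X - (d a)%:P)
  = \prod_a ('X - (d a)%:P) ^+ #|[set i | p i == a]|
    * \det (\matrix_(a, c) (('X - (d a)%:P) *+ (a == c)
              - (b a c *+ #|[set i | p i == c]|)%:P)).
Proof.
pose N : 'M[{poly R}]_n := diag_mx (\row_i ('X - (d (p i))%:P)).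
pose N3 : 'M[{poly R}]_k := diag_mx (\row_a ('X - (d a)%:P)).
pose P : 'M[{poly R}]_(n, k) := \matrix_(i, a) (p i == a)%:R.
pose B : 'M[{poly R}]_k := \matrix_(a, c) (b a c)%:P.
have PBE i j : (P *m (B *m P^T)) i j = (b (p i) (p j))%:P.
  rewrite !mxE (bigD1 (p i)) //= big1 => [|a /negPf ne]; last first.
    by rewrite !mxE eq_sym ne mul0r.
  rewrite addr0 !mxE eqxx mul1r (bigD1 (p j)) //= big1 => [|a /negPf ne].
    by rewrite !mxE eqxx mulr1 addr0.
  by rewrite !mxE eq_sym ne mulr0.
have -> : char_poly (\matrix_(i, j) (d (p i) *+ (i == j) + b (p i) (p j)))
    = \det (N - P *m (B *m P^T)).
  congr (\det _); apply/matrixP => i j; rewrite [RHS]mxE [X in _ = _ + X]mxE PBE.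
  rewrite !mxE raddfD raddfMn /=.
  by case: eqP => _; rewrite ?mulr1n ?mulr0n ?add0r // opprD addrA.
have comm : N *m P = P *m N3.
  apply/matrixP => i a; rewrite mul_diag_mx mul_mx_diag !mxE.
  by case: eqP => [->|_]; rewrite ?mulr0 ?mul0r ?mul1r ?mulr1.
have detM : \det (block_mx N P (B *m P^T) 1%:M) = \det (N - P *m (B *m P^T)).
  have : block_mx 1%:M (- P) 0 1%:M *m block_mx N P (B *m P^T) 1%:M
      = block_mx (N - P *m (B *m P^T)) 0 (B *m P^T) 1%:M.
    by rewrite mulmx_block !mul1mx !mul0mx mulmx1 subrr !add0r mulNmx.
  move/(congr1 determinant); rewrite det_mulmx det_ublock det_lblock !det1.
  by rewrite !mul1r mulr1.
have := det_mulmx (block_mx N P (B *m P^T) 1%:M) (block_mx 1%:M (- P) 0 N3).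
rewrite mulmx_block !mulmx1 !mul1mx !mulmx0 !addr0 mulmxN comm addNr det_lblock.
rewrite det_ublock detM !det1 mul1r det_diag => E.
have -> : \prod_a ('X - (d a)%:P) = \det N3.
  by rewrite det_diag; apply: eq_bigr => a _; rewrite mxE.
rewrite -E; congr (_ * _).
  rewrite (partition_big p predT) //=; apply: eq_bigr => a _.
  rewrite -prodr_const; apply: eq_big => [i|i /eqP ia]; first by rewrite inE.
  by rewrite mxE ia.
(* The lower right block is [N3 - B *m (P^T *m P)], where [P^T *m P] is diagonal and holds the part
   sizes. *)
congr (\det _); rewrite mulmxN -mulmxA; apply/matrixP => a c.
rewrite [LHS]mxE [X in X + _]mxE [RHS]mxE addrC; congr (_ - _).
  by rewrite !mxE.
rewrite mxE.
rewrite (bigD1 c) //= big1 => [|e /negPf ne].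
  rewrite addr0 !mxE raddfMn /= -mulr_natr; congr (_ * _).
  rewrite -sum1_card natr_sum; rewrite [RHS]big_mkcond; apply: eq_bigr => i _.
  by rewrite !mxE inE; case: eqP; rewrite ?mulr1 ?mul0r.
rewrite !mxE big1 ?mulr0 // => i _; rewrite !mxE.
by case: eqP => [->|_]; rewrite ?mul0r // ne mulr0.
Qed.

(** The two small parts have equal size, so the 3 x 3 quotient splits. Vectors opposite on these
    parts give [d1 - e * b.+1%:R]; those equal on them leave a quadratic whose roots [r1], [r2] are
    specified by sum and product. Sizes are successors because each part contributes its size minus
    one to the multiplicity of its diagonal value. *)
Lemma char_poly_tripartite (R : rcfType) n (p : 'I_n -> 'I_3) s b (d0 d1 e r1 r2 : R) :
  #|[set i | p i == ord0]| = s.+1 ->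
  (forall a, a != ord0 -> #|[set i | p i == a]| = b.+1) ->
  r1 + r2 = d0 + d1 + e * b.+1%:R ->
  r1 * r2 = d0 * (d1 + e * b.+1%:R) - 2 * e ^+ 2 * s.+1%:R * b.+1%:R ->
  spec_is (\matrix_(i, j) ((if p i == ord0 then d0 else d1) *+ (i == j)
                           + e * (p i != p j)%:R))
    (nseq s d0 ++ nseq (2 * b) d1 ++ [:: d1 - e * b.+1%:R; r1; r2]).
Proof.
move=> cs cb r12D r12M.
pose d (a : 'I_3) := if a == ord0 then d0 else d1.
have := char_poly_block_constant p d (fun a c => e * (a != c)%:R).
rewrite /spec_is !big_cat /= !big_nseq !iter_mulr_1 !big_cons big_nil mulr1.
set chi := char_poly _.
rewrite !big_ord_recl !big_ord0 det_mx33 !mxE.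
have inord1 : inord 1 = lift ord0 ord0 :> 'I_3 by apply/val_inj; rewrite /= inordK.
have inord2 : inord 2 = lift ord0 (lift ord0 ord0) :> 'I_3.
  by apply/val_inj; rewrite /= inordK.
have inord0 : inord 0 = ord0 :> 'I_3 by apply/val_inj; rewrite /= inordK.
rewrite !inord1 !inord2 !inord0 cs !cb // /d /= !mulr1n !mulr0n ?mulr0 ?mul0rn ?mulr1.
rewrite ?subr0 ?sub0r.
have quad : ('X - r1%:P) * ('X - r2%:P)
    = 'X ^+ 2 - (r1 + r2)%:P * 'X + (r1 * r2)%:P by ring.
rewrite quad r12D r12M -[(e *+ s.+1)]mulr_natr -[(e *+ b.+1)]mulr_natr => chiE.
(* This is the extra factor carried by the block identity; it is cancelled to isolate [chi]. *)
have nz : ('X - d0%:P) * (('X - d1%:P) * ('X - d1%:P)) != 0.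
  by rewrite !mulf_neq0 ?polyXsubC_eq0.
apply: (mulIf nz); rewrite chiE !exprS mulnC exprM; ring.
Qed.

(** * Spectra of complete tripartite graphs with two equal parts *)

Lemma tripartite_degree (R : rcfType) n (A : 'M[R]_n) (p : 'I_n -> 'I_3) s b i :
  (forall i j, A i j = (p i != p j)%:R) ->
  #|[set i | p i == ord0]| = s ->
  (forall a, a != ord0 -> #|[set i | p i == a]| = b) ->
  \sum_j A i j = if p i == ord0 then 2 * b%:R else s%:R + b%:R.
Proof.
move=> AE cs cb.
rewrite (partition_big p predT) //=.
have -> : \sum_a \sum_(j | p j == a) A i j
    = \sum_a (p i != a)%:R * #|[set j | p j == a]|%:R.
  apply: eq_bigr => a _; rewrite -sum1_card natr_sum mulr_sumr.
  by apply: eq_big => [j|j /eqP <-]; rewrite ?inE // AE mulr1.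
rewrite !big_ord_recl big_ord0 cs !cb //.
have : p i \in [:: ord0; lift ord0 ord0; lift ord0 (lift ord0 ord0)].
  by case: (p i) => [[|[|[|?]]]] ?; rewrite !inE -!val_eqE.
by rewrite !inE => /or3P[]/eqP-> /=; ring.
Qed.

(** All three matrices are diagonal plus [e] times the adjacency matrix: zero diagonal and [e = 1]
    for [A], the degrees [2 * B] and [S + B] with [e = -1] or [e = 1] for the Laplacians. Only for
    the Laplacian is the quadratic solved here, with roots [S + 2 * B] and 0. *)
Lemma tripartite_spectra (R : rcfType) n (A : 'M[R]_n) (p : 'I_n -> 'I_3) s b :
  (forall i j, A i j = (p i != p j)%:R) ->
  #|[set i | p i == ord0]| = s.+1 ->
  (forall a, a != ord0 -> #|[set i | p i == a]| = b.+1) ->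
  let S := s.+1%:R in let B := b.+1%:R in
  [/\ forall r1 r2, r1 + r2 = B -> r1 * r2 = - (2 * S * B) ->
        spec_is A (nseq s 0 ++ nseq (2 * b) 0 ++ [:: - B; r1; r2]),
      spec_is (laplmx A)
        (nseq s (2 * B) ++ nseq (2 * b) (S + B) ++ [:: S + 2 * B; S + 2 * B; 0]),
      forall r1 r2, r1 + r2 = S + 4 * B -> r1 * r2 = 4 * B ^+ 2 ->
        spec_is (slaplmx A)
          (nseq s (2 * B) ++ nseq (2 * b) (S + B) ++ [:: S; r1; r2])
    & avgdeg A = (4 * S * B + 2 * B ^+ 2) / (S + 2 * B)].
Proof.
move=> AE cs cb S B.
have degE i := tripartite_degree i AE cs cb.
split=> [r1 r2 r12D r12M||r1 r2 r12D r12M|].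
- have := @char_poly_tripartite R n p s b 0 0 1 r1 r2 cs cb.
  rewrite -/S -/B sub0r mul1r => spec.
  have -> : A = \matrix_(i, j) ((if p i == ord0 then 0 else 0) *+ (i == j)
                           + 1 * (p i != p j)%:R).
    by apply/matrixP=> i j; rewrite mxE AE if_same mul0rn mul1r add0r.
  by apply: spec; rewrite ?r12D ?r12M; ring.
- have := @char_poly_tripartite R n p s b (2 * B) (S + B) (- 1) (S + 2 * B) 0 cs cb.
  have -> : S + B - -1 * b.+1%:R = S + 2 * B by rewrite /B; ring.
  have -> : laplmx A = \matrix_(i, j) ((if p i == ord0 then 2 * B else S + B)
                           *+ (i == j) + - 1 * (p i != p j)%:R).
    by apply/matrixP=> i j; rewrite !mxE degE AE mulN1r.
  by apply; rewrite /S /B; ring.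
- have := @char_poly_tripartite R n p s b (2 * B) (S + B) 1 r1 r2 cs cb.
  have -> : S + B - 1 * b.+1%:R = S by rewrite /B; ring.
  have -> : slaplmx A = \matrix_(i, j) ((if p i == ord0 then 2 * B else S + B)
                           *+ (i == j) + 1 * (p i != p j)%:R).
    by apply/matrixP=> i j; rewrite !mxE degE AE mul1r.
  by apply; rewrite ?r12D ?r12M /S /B; ring.
rewrite /avgdeg; congr (_ / _); last first.
  rewrite -[n in LHS]card_ord -sum1_card natr_sum (partition_big p predT) //=.
  have cE (a : 'I_3) : \sum_(i | p i == a) (1 : R) = #|[set i | p i == a]|%:R.
    by rewrite -sum1_card natr_sum; apply: eq_bigl => i; rewrite inE.
  by rewrite !big_ord_recl big_ord0 !cE cs !cb // /S /B; ring.
rewrite (partition_big p predT) //=.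
have -> : \sum_a \sum_(i | p i == a) \sum_j A i j
    = \sum_a (if a == ord0 then 2 * B else S + B) * #|[set i | p i == a]|%:R.
  apply: eq_bigr => a _; rewrite -sum1_card natr_sum mulr_sumr.
  by apply: eq_big => [i|i /eqP <-]; rewrite ?inE // degE mulr1.
by rewrite !big_ord_recl big_ord0 cs !cb //= -/S -/B; ring.
Qed.

(** * Explicit spectra and energies for each parity *)

Lemma spec_is_perm (R : rcfType) n (M : 'M[R]_n) s t :
  perm_eq s t -> spec_is M s -> spec_is M t.
Proof. by move=> st; rewrite /spec_is => ->; apply: perm_big. Qed.

Lemma sum_seq_nseq (R : pzRingType) (T : Type) n (x : T) (F : T -> R) :
  \sum_(i <- nseq n x) F i = n%:R * F x.
Proof. by rewrite big_nseq iter_addr_0 mulr_natl. Qed.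

Lemma tripartite_energies_even (R : rcfType) n (A : 'M[R]_n) (p : 'I_n -> 'I_3) m :
  (1 < m)%N -> ~~ odd m ->
  (forall i j, A i j = (p i != p j)%:R) ->
  #|[set i | p i == ord0]| = (2 * m - 2)%N ->
  (forall a, a != ord0 -> #|[set i | p i == a]| = 2%N) ->
  let M := m%:R : R in
  spec_is A (nseq (2 * m - 1) 0 ++
                   [:: -2; 1 + Num.sqrt (8 * M - 7); 1 - Num.sqrt (8 * M - 7)]) /\
        energy_is A (2 * (1 + Num.sqrt (8 * M - 7))) /\
        spec_is (laplmx A) ([:: 0] ++ nseq (2 * m - 3) 4 ++
                   [:: 2 * M; 2 * M; 2 * (M + 1); 2 * (M + 1)]) /\
        lapl_energy_is A (16 * (M - 1) * (M - 2) / (M + 1) + 8) /\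
        spec_is (slaplmx A) (nseq (2 * m - 3) 4 ++
                   [:: 2 * M; 2 * M; 2 * (M - 1);
                       M + 3 + Num.sqrt ((M - 1) * (M + 7));
                       M + 3 - Num.sqrt ((M - 1) * (M + 7))]) /\
        slapl_energy_is A
          (if m == 2%N then 8
           else 16 * (M - 1) * (M - 2) / (M + 1)
                + 2 * (M - 1) * (Num.sqrt (1 + 8 / (M - 1)) - 1)).
Proof.
move=> m_gt1 m_even AE cs cb M.
have M2 : 2 <= M by rewrite ler_nat.
have M4 : m != 2%N -> 4 <= M.
  by move=> m2; rewrite ler_nat; case: m m_gt1 m_even m2 {M M2 cs} => [|[|[|[|]]]].
have [s sE] : exists s, (2 * m - 2 = s.+1)%N by exists (2 * m - 3)%N; lia.
have s3 : (2 * m - 3 = s)%N by lia.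
have m1 : (2 * m - 1 = s + 2)%N by lia.
have SM : s.+1%:R = 2 * M - 2 :> R by rewrite -sE natrB ?natrM //; lia.
have sM : s%:R = 2 * M - 3 :> R by move: SM; rewrite -natr1 => SM; lra.
rewrite sE in cs; rewrite s3 m1.
have [specA specL specQ avg] := tripartite_spectra AE cs cb.
rewrite SM in specA specL specQ avg.
have M1n : M + 1 != 0 by lra.
have avgE : avgdeg A = 8 - 12 / (M + 1).
  by rewrite avg; field; rewrite M1n; lra.
set q := Num.sqrt (8 * M - 7).
have q2 : q ^+ 2 = 8 * M - 7 by rewrite sqr_sqrtr //; lra.
have q1 : 1 <= q by rewrite -sqrtr1 ler_wsqrtr //; lra.
set t := Num.sqrt ((M - 1) * (M + 7)).
have t2 : t ^+ 2 = (M - 1) * (M + 7) by rewrite sqr_sqrtr // mulr_ge0; lra.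
have t0 : 0 <= t by rewrite sqrtr_ge0.
have t1 : M - 1 <= t by nra.
(* The average degree is [8 - u]; the energies reduce to deciding which eigenvalues exceed it. *)
set u := 12 / (M + 1) in avgE *.
have uM : u * (M + 1) = 12 by rewrite /u divfK.
(* The large part supplies [s] zeros and the two parts of size 2 supply one each. *)
have sA : spec_is A (nseq (s + 2) 0 ++ [:: -2; 1 + q; 1 - q]).
  rewrite nseqD -catA; apply: specA; first by ring.
  have -> : (1 + q) * (1 - q) = 1 - q ^+ 2 by ring.
  by rewrite q2; ring.
have sL : spec_is (laplmx A) ([:: 0] ++ nseq s 4 ++
             [:: 2 * M; 2 * M; 2 * (M + 1); 2 * (M + 1)]).
  apply: spec_is_perm specL; apply/seq.permP => a.
  have -> : 2 * 2 = 4 :> R by ring.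
  have -> : 2 * M - 2 + 2 = 2 * M by ring.
  have -> : 2 * M - 2 + 4 = 2 * (M + 1) by ring.
  by rewrite !count_cat !count_nseq /=; ring.
have sQ : spec_is (slaplmx A) (nseq s 4 ++
             [:: 2 * M; 2 * M; 2 * (M - 1); M + 3 + t; M + 3 - t]).
  have := specQ (M + 3 + t) (M + 3 - t).
  have -> : 2 * 2 = 4 :> R by ring.
  have -> : 2 * M - 2 + 2 = 2 * M by ring.
  have -> : 2 * M - 2 = 2 * (M - 1) by ring.
  have -> : (M + 3 + t) * (M + 3 - t) = (M + 3) ^+ 2 - t ^+ 2 by ring.
  by apply; rewrite ?t2; ring.
split=> //; split.
  eexists; split; first exact: sA.
  rewrite big_cat sum_seq_nseq !big_cons big_nil normr0 mulr0 /=.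
  rewrite normrN [`|2|]ger0_norm ?[`|1 + q|]ger0_norm ?[`|1 - q|]ler0_norm; lra.
split=> //; split.
  eexists; split; first exact: sL.
  rewrite !big_cat sum_seq_nseq !big_cons !big_nil /= avgE sM.
  have u4 : u <= 4 by nra.
  have um : 8 - u <= 2 * M by nra.
  rewrite ler0_norm ?[`|4 - _|]ler0_norm ?ger0_norm; try lra.
  by rewrite /u; field.
split=> //.
eexists; split; first exact: sQ.
rewrite !big_cat sum_seq_nseq !big_cons !big_nil /= avgE sM.
(* The eigenvalue [2 * (M - 1)] lies below the average degree only for [m = 2], hence the separate
   value. *)
case: eqP => [m2|/eqP/M4{}M4].
  have ME : M = 2 by rewrite /M m2.
  have tE : t = 3 by apply/eqP; rewrite -(@eqrXn2 _ 2) // ?t2 ?ME //; apply/eqP; ring.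
  have uE : u = 4 by rewrite ME in uM; lra.
  rewrite uE tE ME.
  rewrite [`|2 * 2 - _|]ger0_norm ?[`|0 - _|]ler0_norm; try lra.
  rewrite [`|4 - _|]ger0_norm ?[`|2 * (2 - 1) - _|]ler0_norm; try lra.
  rewrite [`|2 + 3 + 3 - _|]ger0_norm ?[`|2 + 3 - 3 - _|]ler0_norm; lra.
have u4 : u <= 4 by nra.
have um : 8 - u <= 2 * (M - 1) by nra.
set w := Num.sqrt (1 + 8 / (M - 1)).
(* Both sides are nonnegative with square [(M - 1) * (M + 7)]. *)
have wt : (M - 1) * w = t.
  apply/eqP; rewrite -(@eqrXn2 _ 2) ?mulr_ge0 ?sqrtr_ge0 //; last by lra.
  rewrite exprMn sqr_sqrtr ?t2; first by apply/eqP; field; lra.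
  by rewrite addr_ge0 // divr_ge0 //; lra.
rewrite [`|4 - _|]ler0_norm ?[`|2 * M - _|]ger0_norm; try lra.
rewrite [`|2 * (M - 1) - _|]ger0_norm; last by lra.
rewrite [`|M + 3 + t - _|]ger0_norm; last by lra.
rewrite [`|M + 3 - t - _|]ler0_norm; last by lra.
have -> : 2 * (M - 1) * (w - 1) = 2 * (t - (M - 1)) by rewrite -wt; ring.
by rewrite /u; field.
Qed.

Lemma tripartite_energies_odd (R : rcfType) n (A : 'M[R]_n) (p : 'I_n -> 'I_3) m :
  (1 < m)%N -> odd m ->
  (forall i j, A i j = (p i != p j)%:R) ->
  #|[set i | p i == ord0]| = (2 * m - 1)%N ->
  (forall a, a != ord0 -> #|[set i | p i == a]| = 1%N) ->
  let M := m%:R : R in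
  spec_is A (nseq (2 * m - 2) 0 ++
                   [:: -1; (1 + Num.sqrt (16 * M - 7)) / 2;
                           (1 - Num.sqrt (16 * M - 7)) / 2]) /\
        energy_is A (1 + Num.sqrt (16 * M - 7)) /\
        spec_is (laplmx A) ([:: 0] ++ nseq (2 * m - 2) 2 ++
                   [:: 2 * M + 1; 2 * M + 1]) /\
        lapl_energy_is A (((4 * M - 2) ^+ 2 + 8) / (2 * M + 1)) /\
        spec_is (slaplmx A) (nseq (2 * m - 2) 2 ++
                   [:: 2 * M - 1;
                       (2 * M + 3 + Num.sqrt ((2 * M - 1) * (2 * M + 7))) / 2;
                       (2 * M + 3 - Num.sqrt ((2 * M - 1) * (2 * M + 7))) / 2]) /\
        slapl_energy_is A
          (3 * (2 * M - 1) * (2 * M - 3) / (2 * M + 1)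
           + (2 * M - 1) * Num.sqrt (1 + 8 / (2 * M - 1))).
Proof.
move=> m_gt1 m_odd AE cs cb M.
(* With [M] at least 3, the eigenvalue [2 * M - 1] always exceeds the average degree [4 - u], so no
   exceptional case arises. *)
have M3 : 3 <= M by rewrite ler_nat; case: m m_gt1 m_odd {M cs} => [|[|[|]]].
have [s sE] : exists s, (2 * m - 1 = s.+1)%N by exists (2 * m - 2)%N; lia.
have s2 : (2 * m - 2 = s)%N by lia.
have SM : s.+1%:R = 2 * M - 1 :> R by rewrite -sE natrB ?natrM //; lia.
have sM : s%:R = 2 * M - 2 :> R by move: SM; rewrite -natr1 => SM; lra.
rewrite sE in cs; rewrite s2.
have [specA specL specQ avg] := tripartite_spectra AE cs cb.
rewrite SM !mulr1 in specA specL specQ avg.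
have M1n : 2 * M + 1 != 0 by lra.
have avgE : avgdeg A = 4 - 6 / (2 * M + 1).
  by rewrite avg; field; rewrite M1n; lra.
set q := Num.sqrt (16 * M - 7).
have q2 : q ^+ 2 = 16 * M - 7 by rewrite sqr_sqrtr //; lra.
have q1 : 1 <= q by rewrite -sqrtr1 ler_wsqrtr //; lra.
set t := Num.sqrt ((2 * M - 1) * (2 * M + 7)).
have t2 : t ^+ 2 = (2 * M - 1) * (2 * M + 7) by rewrite sqr_sqrtr // mulr_ge0; lra.
have t0 : 0 <= t by rewrite sqrtr_ge0.
(* This gives [(2 * M + 3 - t) / 2 <= 2], which places that eigenvalue below the average degree. *)
have t1 : 2 * M - 1 <= t by nra.
set u := 6 / (2 * M + 1) in avgE *.
have uM : u * (2 * M + 1) = 6 by rewrite /u divfK.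
have u1 : 0 <= u <= 1 by nra.
have sA : spec_is A (nseq s 0 ++ [:: -1; (1 + q) / 2; (1 - q) / 2]).
  apply: specA; first by field.
  have -> : (1 + q) / 2 * ((1 - q) / 2) = (1 - q ^+ 2) / 4 by field.
  by rewrite q2; field.
have sL : spec_is (laplmx A) ([:: 0] ++ nseq s 2 ++ [:: 2 * M + 1; 2 * M + 1]).
  apply: spec_is_perm specL; apply/seq.permP => a.
  have -> : 2 * M - 1 + 2 = 2 * M + 1 by ring.
  by rewrite !count_cat !count_nseq /=; ring.
have sQ : spec_is (slaplmx A) (nseq s 2 ++
             [:: 2 * M - 1; (2 * M + 3 + t) / 2; (2 * M + 3 - t) / 2]).
  apply: specQ; first by field.
  have -> : (2 * M + 3 + t) / 2 * ((2 * M + 3 - t) / 2)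
    = ((2 * M + 3) ^+ 2 - t ^+ 2) / 4 by field.
  by rewrite t2; field.
split=> //; split.
  eexists; split; first exact: sA.
  rewrite big_cat sum_seq_nseq !big_cons big_nil normr0 mulr0 normrN normr1 /=.
  rewrite [`|(1 + q) / 2|]ger0_norm ?[`|(1 - q) / 2|]ler0_norm; lra.
split=> //; split.
  eexists; split; first exact: sL.
  rewrite !big_cat sum_seq_nseq !big_cons !big_nil /= avgE sM.
  rewrite ler0_norm ?[`|2 - _|]ler0_norm ?ger0_norm; try lra.
  by rewrite /u; field.
split=> //.
eexists; split; first exact: sQ.
rewrite !big_cat sum_seq_nseq !big_cons !big_nil /= avgE sM.
set w := Num.sqrt (1 + 8 / (2 * M - 1)).
have wt : (2 * M - 1) * w = t.
  apply/eqP; rewrite -(@eqrXn2 _ 2) ?mulr_ge0 ?sqrtr_ge0 //; last by lra.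
  rewrite exprMn sqr_sqrtr ?t2; first by apply/eqP; field; lra.
  by rewrite addr_ge0 // divr_ge0 //; lra.
rewrite [`|2 - _|]ler0_norm ?[`|2 * M - 1 - _|]ger0_norm; try lra.
rewrite [`|(2 * M + 3 + t) / 2 - _|]ger0_norm; last by lra.
rewrite [`|(2 * M + 3 - t) / 2 - _|]ler0_norm; last by lra.
by rewrite wt /u; field.
Qed.

(** * The NCCC-graph of the presented group *)

Theorem theorem2p11 (R : rcfType) (gT : finGroupType) (G : {group gT}) (m : nat) :
  (2 <= m)%N ->
  (G \isog Grp (x : y : (x ^+ (2 * m) = 1, y ^+ 4 = 1,
                 y * x = x^-1 * y^-1, y^-1 * x = x^-1 * y)))%g ->
  let A := nccc_adjmx R G in
  let M := m%:R : R in
  if ~~ odd m then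
    (spec_is A (nseq (2 * m - 1) 0 ++
                   [:: -2; 1 + Num.sqrt (8 * M - 7); 1 - Num.sqrt (8 * M - 7)]) /\
        energy_is A (2 * (1 + Num.sqrt (8 * M - 7))) /\
        spec_is (laplmx A) ([:: 0] ++ nseq (2 * m - 3) 4 ++
                   [:: 2 * M; 2 * M; 2 * (M + 1); 2 * (M + 1)]) /\
        lapl_energy_is A (16 * (M - 1) * (M - 2) / (M + 1) + 8) /\
        spec_is (slaplmx A) (nseq (2 * m - 3) 4 ++
                   [:: 2 * M; 2 * M; 2 * (M - 1);
                       M + 3 + Num.sqrt ((M - 1) * (M + 7));
                       M + 3 - Num.sqrt ((M - 1) * (M + 7))]) /\
        slapl_energy_is A
          (if m == 2%N then 8
           else 16 * (M - 1) * (M - 2) / (M + 1)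
                + 2 * (M - 1) * (Num.sqrt (1 + 8 / (M - 1)) - 1)))
  else
    (spec_is A (nseq (2 * m - 2) 0 ++
                   [:: -1; (1 + Num.sqrt (16 * M - 7)) / 2;
                           (1 - Num.sqrt (16 * M - 7)) / 2]) /\
        energy_is A (1 + Num.sqrt (16 * M - 7)) /\
        spec_is (laplmx A) ([:: 0] ++ nseq (2 * m - 2) 2 ++
                   [:: 2 * M + 1; 2 * M + 1]) /\
        lapl_energy_is A (((4 * M - 2) ^+ 2 + 8) / (2 * M + 1)) /\
        spec_is (slaplmx A) (nseq (2 * m - 2) 2 ++
                   [:: 2 * M - 1;
                       (2 * M + 3 + Num.sqrt ((2 * M - 1) * (2 * M + 7))) / 2;
                       (2 * M + 3 - Num.sqrt ((2 * M - 1) * (2 * M + 7))) / 2]) /\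
        slapl_energy_is A
          (3 * (2 * M - 1) * (2 * M - 3) / (2 * M + 1)
           + (2 * M - 1) * Num.sqrt (1 + 8 / (2 * M - 1)))).
Proof.
move=> m_gt1 isoG A M.
have [leG [x [y [genG x2m y4 yx yVx]]]] := V8m_generators m_gt1 isoG.
have [p [adjE c0 c12]] := nccc_adj_V8m_tripartite m_gt1 leG genG x2m y4 yx yVx.
(* The partition of the classes is carried to matrix indices along the enumeration of the
   vertices. *)
pose q (i : 'I_#|nccc_vertices G|) := p (enum_val i).
have AE i j : A i j = (q i != q j)%:R by rewrite mxE adjE ?enum_valP.
have cE a : #|[set i | q i == a]| = #|[set C in nccc_vertices G | p C == a]|.
  rewrite -(card_imset _ enum_val_inj); apply: eq_card => C.
  apply/imsetP/setIdP => [[i]|[CV pC]]; first by rewrite inE => qi ->; rewrite enum_valP.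
  by exists (enum_rank_in CV C); rewrite ?inE /q enum_rankK_in.
have [m_odd|m_even] := boolP (odd m).
  rewrite m_odd in c0 c12.
  apply: (tripartite_energies_odd m_gt1 m_odd AE) => [|a a0]; first by rewrite cE c0.
  by rewrite cE c12.
rewrite (negPf m_even) in c0 c12.
apply: (tripartite_energies_even m_gt1 m_even AE) => [|a a0]; first by rewrite cE c0.
by rewrite cE c12.
Qed.
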